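(* Every SDL space $X$ satisfies $$\operatorname{sqL}(X)\leq t(X),$$ where $\operatorname{sqL}(X)$ is the strict quasi-Lindelöf number and $t(X)$ the tightness of $X$. In particular, every countably tight SDL space (i.e. every SDL space $X$ with $t(X)=\omega$) is strictly quasi-Lindelöf (i.e. satisfies $\operatorname{sqL}(X)=\omega$).
   Context: No separation axiom is assumed on $X$. All cardinal invariants are taken to be infinite cardinals. Closures are taken in $X$. $[A]^{\leq\kappa}$ denotes the family of all subsets of $A$ of cardinality at most $\kappa$. A space is Lindelöf if every open cover has a countable subcover (no separation axiom is included). Strongly discrete: a subset $D$ of a topological space $X$ is strongly discrete if there is a family $\{W_d:d\in D\}$ of pairwise disjoint open subsets of $X$ (indexed by $D$) with $d\in W_d$ for every $d\in D$. SDL space: $X$ is an SDL space if the closure $\overline{D}$ in $X$ is Lindelöf for every strongly discrete subset $D$ of $X$. Tightness: for $x\in X$, $t(x,X)$ is the least infinite cardinal $\kappa$ such that whenever $A\subseteq X$ and $x\in\overline{A}$, there is $B\subseteq A$ with $|B|\leq\kappa$ and $x\in\overline{B}$; $t(X)=\sup\{t(x,X):x\in X\}$. Strict quasi-Lindelöf number: $\operatorname{sqL}(X)$ is the least infinite cardinal $\kappa$ such that for every closed set $F\subseteq X$, every open cover $\mathcal U$ of $F$ (a family of open subsets of $X$ whose union contains $F$), and every decomposition $\mathcal U=\bigcup_{i\in I}\mathcal U_i$ with $|I|\leq\kappa$, there are families $\mathcal V_i\in[\mathcal U_i]^{\leq\kappa}$ ($i\in I$) such that $F\subseteq\bigcup_{i\in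 I}\overline{\bigcup\mathcal V_i}$. The space $X$ is strictly quasi-Lindelöf if $\operatorname{sqL}(X)=\omega$. *)

(* Defs.v *)
From mathcomp Require Import all_boot all_classical topology_structure subtype_topology.

Set Implicit Arguments.
Unset Strict Implicit.
Unset Printing Implicit Defensive.

Local Open Scope classical_set_scope.
Local Open Scope card_scope.

(* A cardinal is represented by a type of that size and compared through      *)
(* [card_le]; two types stand for the same cardinal when they are equipotent. *)
Definition is_least_card (P : Type -> Prop) (K : Type) : Prop :=
  [/\ infinite_set [set: K], P K &
      forall L : Type, infinite_set [set: L] -> P L -> [set: K] #<= [set: L]].

(* The value [nat] is a dummy, never reached below: see [least_cardP].        *)
Definition least_card (P : Type -> Prop) : Type :=
  if pselect (exists K, is_least_card P K) is left e then sval (cid e) else nat.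

Lemma inj_card_leT (A B : Type) (f : A -> B) :
  injective f -> [set: A] #<= [set: B].
Proof.
move=> finj; have : f @` [set: A] #= [set: A] by apply: inj_card_eq; exact: in2W.
rewrite card_eq_le => /andP[_ /card_le_trans]; apply.
exact: subset_card_le.
Qed.

(* Take a maximal set of choice functions on which every projection is        *)
(* injective; some projection is then onto.                                   *)
Lemma exists_smallest_type (I : Type) (X : I -> Type) (i0 : I) :
  exists i, forall j, [set: X i] #<= [set: X j].
Proof.
pose inj_proj (G : set (forall i, X i)) := forall (i : I) f g,
  G f -> G g -> f i = g i -> f = g.
have [F sF totF|G [Ginj Gmax]] := @Zorn_bigcup _ inj_proj.
  move=> i f g [A FA Af] [B FB Bg].
  have [AB|BA] := totF _ _ FA FB.
    by apply: (sF _ FB) => //; exact: AB.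
  by apply: (sF _ FA) => //; exact: BA.
have [[i Gonto]|Gnonto] := pselect
    (exists i : I, forall y, exists f, G f /\ f i = y); last first.
  have hex i : exists y : X i, forall f, G f -> f i <> y.
    apply: contrapT => /forallNP H; apply: Gnonto; exists i => y.
    have /existsNP[f /not_implyP[Gf /contrapT fy]] := H y.
    by exists f.
  pose h i := projT1 (cid (hex i)); have hP i := projT2 (cid (hex i)).
  exfalso; apply: (Gmax (G `|` [set h])).
    split; first exact: subsetUl.
    by move=> /(_ h (or_intror erefl)) Gh; exact: (hP i0 h).
  move=> i f g [Gf|->] [Gg|->] //; first exact: Ginj.
  - by move=> /(hP i _ Gf).
  - by move=> /esym /(hP i _ Gg).
have [w wP] := choice Gonto.
exists i => j; apply: (@inj_card_leT _ _ (fun y => w y j)) => y z wyz.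
have [Gy <-] := wP y; have [Gz <-] := wP z.
by rewrite (Ginj j _ _ Gy Gz wyz).
Qed.

Lemma card_le_totalT (A B : Type) :
  [set: A] #<= [set: B] \/ [set: B] #<= [set: A].
Proof.
have [[] H] := @exists_smallest_type bool (fun b => if b then A else B) true.
  by left; exact: (H false).
by right; exact: (H true).
Qed.

Lemma exists_least_card (P : Type -> Prop) :
  (exists2 K, infinite_set [set: K] & P K) -> exists K, is_least_card P K.
Proof.
move=> [K0 K0inf PK0].
pose Q K := infinite_set [set: K] /\ P K.
pose I := {A : set K0 | exists K, Q K /\ A #= [set: K]}.
have i0 : I by exists setT, K0; split.
have [i imin] := exists_smallest_type (fun i : I => set_type (sval i)) i0.
have [K [[Kinf PK] iK]] := svalP i.
have KiP : [set: K] #<= sval i by move: iK; rewrite card_eq_le => /andP[].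
exists K; split=> // L Linf PL; apply: (card_le_trans KiP).
have [LK0|K0L] := card_le_totalT L K0; last first.
  by apply: card_le_trans K0L; exact: subset_card_le.
have /card_subP[A AL _] := LK0.
pose j : I := exist _ A (ex_intro _ L (conj (conj Linf PL) AL)).
rewrite -(card_le_eql (card_setT (sval i))) -(card_le_eqr AL).
by rewrite -(card_le_eqr (card_setT A)); exact: (imin j).
Qed.

Lemma least_cardP (P : Type -> Prop) :
  (exists2 K, infinite_set [set: K] & P K) -> is_least_card P (least_card P).
Proof.
move=> /exists_least_card exK; rewrite /least_card.
by case: pselect => // e; exact: (svalP (cid e)).
Qed.

Definition lindelof_space (T : topologicalType) : Prop :=
  forall U : set (set T), U `<=` open -> \bigcup_(V in U) V = [set: T] ->
  exists V : set (set T),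
    [/\ V `<=` U, countable V & \bigcup_(W in V) W = [set: T]].

Definition strongly_discrete (X : topologicalType) (D : set X) : Prop :=
  exists W : X -> set X,
    (forall d, D d -> open (W d) /\ W d d) /\ trivIset D W.

(* [set_type A] carries the subspace topology. *)
Definition SDL_space (X : topologicalType) : Prop :=
  forall D : set X, strongly_discrete D ->
    lindelof_space (set_type (closure D)).

Definition tight_at (X : topologicalType) (x : X) (K : Type) : Prop :=
  forall A : set X, closure A x ->
  exists B : set X, [/\ B `<=` A, B #<= [set: K] & closure B x].

Definition tightness_at (X : topologicalType) (x : X) : Type :=
  least_card (tight_at x).

(* The supremum is the least infinite upper bound, hence omega if X is empty. *)
Definition tightness (X : topologicalType) : Type :=
  least_card (fun K => forall x : X, [set: tightness_at x] #<= [set: K]).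

Definition strictly_quasi_lindelof_at (X : topologicalType) (K : Type) : Prop :=
  forall (F : set X) (U : set (set X)) (I : Type) (Ui : I -> set (set X)),
    closed F -> U `<=` open -> F `<=` \bigcup_(O in U) O ->
    [set: I] #<= [set: K] -> U = \bigcup_i Ui i ->
  exists V : I -> set (set X),
    (forall i, V i `<=` Ui i /\ V i #<= [set: K]) /\
    F `<=` \bigcup_i closure (\bigcup_(O in V i) O).

Definition sqL (X : topologicalType) : Type :=
  least_card (strictly_quasi_lindelof_at X).

Definition countably_tight (X : topologicalType) : Prop :=
  [set: tightness X] #= [set: nat].

Definition strictly_quasi_lindelof (X : topologicalType) : Prop :=
  [set: sqL X] #= [set: nat].

Lemma infinite_sum_nat (A : Type) : infinite_set [set: A + nat].
Proof. by apply/infiniteP/(@inj_card_leT _ _ inr) => ? ? []. Qed.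

Lemma card_le_sum_nat (A : Type) (B : set A) : B #<= [set: A + nat].
Proof.
apply: (@card_le_trans _ _ _ [set: A]); first exact: subset_card_le.
by apply: (@inj_card_leT _ _ inl) => ? ? [].
Qed.

Lemma tightness_atP (X : topologicalType) (x : X) :
  is_least_card (tight_at x) (tightness_at x).
Proof.
apply: least_cardP; exists (X + nat)%type; first exact: infinite_sum_nat.
by move=> A Ax; exists A; split=> //; exact: card_le_sum_nat.
Qed.

Lemma tightnessP (X : topologicalType) :
  is_least_card (fun K => forall x : X, [set: tightness_at x] #<= [set: K])
    (tightness X).
Proof.
apply: least_cardP; exists (X + nat)%type; first exact: infinite_sum_nat.
move=> x; have [_ _] := tightness_atP x; apply; first exact: infinite_sum_nat.
by move=> A Ax; exists A; split=> //; exact: card_le_sum_nat.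
Qed.

Lemma sqLP (X : topologicalType) :
  is_least_card (strictly_quasi_lindelof_at X) (sqL X).
Proof.
apply: least_cardP; exists (set X + nat)%type.
  exact: infinite_sum_nat.
move=> F U I Ui _ _ FU _ UE; exists Ui; split.
  by move=> i; split=> //; exact: card_le_sum_nat.
move=> x /FU[O]; rewrite UE => -[i _ UiO] Ox; exists i => //.
by apply: subset_closure; exists O.
Qed.

(* Main.v *)
Require Import Defs.
From mathcomp Require Import all_boot all_classical topology_structure subtype_topology.
From mathcomp Require Import wochoice.

(** Write kappa for an infinite cardinal such that every point of the SDL space
    X has tightness at most kappa; kappa is represented by a type K. Let U be an
    open cover of a closed set F, and the union of families Ui i with i ranging
    over at most kappa indices, and suppose that no subfamilies of the Ui i of
    size at most kappa are as the strict quasi-Lindelof property asks. Then, for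
    every subfamily S of U with at most kappa members, some point of F lies
    outside the closure of the union of S `&` Ui i, for every i at once.

    Recursion along a well-order of type kappa^+ uses this to choose families
    V a of at most kappa members of U, increasing in a, points x a of F, indices
    ix a, and members O a of Ui (ix a) containing x a.  The point x a lies
    outside the closure of the union of V a `&` Ui i for every i, and V a is
    made large enough to contain the sets O b with b < a, and to cover, for each
    i, the closure of the set of those x b with b < a and ix b = i.

    The index makes this possible: for a fixed i, the points x a with ix a = i
    form a strongly discrete set, because O a minus the closure of the union of
    V a `&` Ui i is a neighbourhood of x a that misses all earlier O b with
    ix b = i ([strongly_discrete_fresh]).  Hence these sets have Lindelof
    closures, and countably many members of U suffice to cover each closure; in
    total each stage adds at most kappa sets.

    When the recursion is over, let D i be the set of all x a with ix a = i.  As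
    tightness is at most kappa and sets of kappa stages are bounded, the closure
    of D i is covered by the sets in the families V a; a countable subcover is
    contained in a single V (b i).  A stage a beyond all the b i gives the
    contradiction: x a belongs to D (ix a), hence to a member of V a, which also
    belongs to some Ui j.

    The cardinal arithmetic needed is that a union of at most kappa sets of
    size at most kappa has size at most kappa ([card_le_bigcup]), which rests on
    kappa * kappa = kappa ([exists_pairing]) and also yields the regularity of
    kappa^+ ([exists_successor_order]). *)

Set Implicit Arguments.
Unset Strict Implicit.
Unset Printing Implicit Defensive.

Local Open Scope classical_set_scope.
Local Open Scope card_scope.

(** * Squares and unions of infinite cardinals *)

Lemma card_le_injP (T K : Type) (k0 : K) (A : set T) (B : set K) :
  A #<= B <-> exists2 f : T -> K, (forall x, A x -> B (f x)) &
    (forall x y, A x -> A y -> f x = f y -> x = y).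
Proof.
elim/Ppointed: K => K in k0 B *; first by case: (no k0).
split=> [/pcard_leP/injfunPex[f fAB finj]|[f fAB finj]].
  by exists f => // x y Ax Ay; apply: finj; rewrite inE.
apply/pcard_leP/injfunPex; exists f => // x y.
by rewrite !inE; exact: finj.
Qed.

Lemma infinite_other (K : Type) (A : set K) (a : K) :
  infinite_set A -> exists2 b, A b & b <> a.
Proof.
move=> Ainf; apply: contrapT => H; apply: Ainf.
apply: (@sub_finite_set _ _ [set a]); last exact: finite_set1.
by move=> b Ab; apply: contrapT => ba; apply: H; exists b.
Qed.

(** Off A the values of f are arbitrary: with total functions, the partial
    pairings in Zorn's lemma below all have the same type. *)
Definition pairing_on (K : Type) (A : set K) (f : K -> K -> K) :=
  (forall a b, A a -> A b -> A (f a b)) /\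
  (forall a b c d, A a -> A b -> A c -> A d -> f a b = f c d -> a = c /\ b = d).

Lemma pairing_on_countable (K : Type) : infinite_set [set: K] ->
  exists (A : set K) f, infinite_set A /\ pairing_on A f.
Proof.
move=> Kinf; have [k0 _] := infinite_setN0 Kinf.
have /(card_le_injP k0)[e _ e_inj] := (infiniteP _).1 Kinf.
have {}e_inj m n : e m = e n -> m = n by exact: e_inj.
have /choice[r rP] : forall k, exists n, range e k -> e n = k.
  move=> k; have [[n _ <-]|nk] := pselect (range e k).
    by exists n.
  by exists 0%N => /nk.
exists (range e), (fun a b => e (pickle (r a, r b))); split.
  apply/infiniteP; have : range e #= [set: nat].
    exact: inj_card_eq (in2W e_inj).
  by rewrite card_eq_le => /andP[].
split=> [a b _ _|a b c d ea eb ec ed]; first by exists (pickle (r a, r b)).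
move=> /e_inj /(pcan_inj pickleK)[rac rbd].
by rewrite -(rP a) // -(rP b) // rac rbd !rP.
Qed.

(** kappa * kappa = kappa, in the form of an injection of K * K into K.  Take a
    maximal pairing f on an infinite subset A.  If the complement of A embeds in
    A, then so does K, because f lets A absorb two copies of itself, and pulling
    f back along this embedding gives a pairing on K.  Otherwise the complement
    contains a copy j @` A of A; the pairs in A `|` j @` A that f does not
    already pair embed in A, hence in that copy, which extends f and contradicts
    maximality. *)
Lemma exists_pairing (K : Type) : infinite_set [set: K] ->
  exists f, pairing_on [set: K] f.
Proof.
move=> Kinf.
pose P := {p : set K * (K -> K -> K) |
  infinite_set p.1 /\ pairing_on p.1 p.2}.
pose extends (p q : P) := (sval p).1 `<=` (sval q).1 /\
  forall a b, (sval p).1 a -> (sval p).1 b ->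
    (sval p).2 a b = (sval q).2 a b.
pose le (p q : P) := `[< extends p q >].
have [A0 [f0 good0]] := pairing_on_countable Kinf.
pose p0 : P := exist _ (A0, f0) good0.
have [p pmax] : exists p, premaximal le p.
  apply: (ZL_preorder p0) => [p|q p r /asboolP[pq pq'] /asboolP[qr qr']|C].
  - by apply/asboolP; split.
  - apply/asboolP; split; first exact: subset_trans qr.
    by move=> a b pa pb; rewrite pq' // qr' //; exact: pq.
  move=> totC0.
  have totC q r : C q -> C r -> extends q r \/ extends r q.
    by move=> Cq Cr; have [/asboolP|/asboolP] := totC0 _ _ Cq Cr; [left|right].
  have [[c Cc]|C0] := pselect (exists c, C c); last first.
    by exists p0 => s Cs; case: C0; exists s.
  pose A := \bigcup_(p in C) (sval p).1.
  have common a b : A a -> A b ->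
      exists p, [/\ C p, (sval p).1 a & (sval p).1 b].
    move=> [p Cp pa] [q Cq qb]; have [[pq _]|[qp _]] := totC _ _ Cp Cq.
      by exists q; split=> //; exact: pq.
    by exists p; split=> //; exact: qp.
  have /choice[f fE] : forall ab : K * K, exists c, forall p, C p ->
      (sval p).1 ab.1 -> (sval p).1 ab.2 -> c = (sval p).2 ab.1 ab.2.
    move=> [a b] /=.
    have [[Aa Ab]|nA] := pselect (A a /\ A b); last first.
      by exists a => p Cp pa pb; case: nA; split; exists p.
    have [q [Cq qa qb]] := common _ _ Aa Ab.
    exists ((sval q).2 a b) => p Cp pa pb.
    by have [[_ ->]|[_ ->]] := totC _ _ Cp Cq.
  have good : infinite_set A /\ pairing_on A (fun a b => f (a, b)).
    split.
      apply: (@sub_infinite_set _ (sval c).1); last by case: (svalP c).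
      by move=> a ca; exists c.
    split=> [a b /common /[apply] -[p [Cp pa pb]]|a b a' b' Aa Ab Aa' Ab'].
      exists p => //; rewrite (fE _ _ Cp) //=.
      by have [_ [+ _]] := svalP p; exact.
    have [p [Cp pa pb]] := common _ _ Aa Ab.
    have [q [Cq qa' qb']] := common _ _ Aa' Ab'.
    have [r [Cr [ra rb ra' rb']]] : exists r, C r /\
        [/\ (sval r).1 a, (sval r).1 b, (sval r).1 a' & (sval r).1 b'].
      have [[pq _]|[qp _]] := totC _ _ Cp Cq.
        by exists q; split=> //; split=> //; exact: pq.
      by exists p; split=> //; split=> //; exact: qp.
    rewrite !(fE _ _ Cr) //=.
    by have [_ [_ +]] := svalP r; exact.
  exists (exist _ (A, fun a b => f (a, b)) good) => q Cq.
  apply/asboolP; split=> /=.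
    by move=> a qa; exists q.
  by move=> a b qa qb; rewrite (fE _ _ Cq).
case: p pmax => -[A f] /= [Ainf fA] pmax.
have [fAA finj] := fA.
have [a0 Aa0] := infinite_setN0 Ainf.
have [a1 Aa1 a10] := infinite_other a0 Ainf.
(* Since A contains two points a0 and a1, A absorbs two copies of itself. *)
have emb (B : set K) (u : K -> K) : (forall k, B k -> ~ A k -> A (u k)) ->
    (forall k l, B k -> B l -> ~ A k -> ~ A l -> u k = u l -> k = l) ->
    exists r, (forall k, B k -> A (r k)) /\
      forall k l, B k -> B l -> r k = r l -> k = l.
  move=> uA u_inj.
  exists (fun k => if pselect (A k) then f a0 k else f a1 (u k)); split.
    by move=> k Bk; case: pselect => Ak; apply: fAA => //; exact: uA.
  move=> k l Bk Bl; case: pselect => Ak; case: pselect => Al.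
  - by move=> /finj[].
  - by move=> /finj[] //; [exact: uA|move=> /esym].
  - by move=> /finj[] //; exact: uA.
  - by move=> /finj[] //; [exact: uA|exact: uA|move=> _; exact: u_inj].
have [CA|AC] := card_le_totalT (set_type (~` A)) (set_type A).
  have {CA} : ~` A #<= A.
    by rewrite -(card_le_eql (card_setT _)) -(card_le_eqr (card_setT _)).
  move=> /(card_le_injP a0)[u uA u_inj].
  have [|k l _ _|r [rA r_inj]] := emb [set: K] u.
  - by move=> k _; exact: uA.
  - exact: u_inj.
  exists (fun a b => f (r a) (r b)); split=> // a b c d _ _ _ _.
  by move=> /finj[]; [exact: rA..|]; move=> /r_inj-> // /r_inj->.
have {AC} : A #<= ~` A.
  by rewrite -(card_le_eql (card_setT _)) -(card_le_eqr (card_setT _)).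
move=> /(card_le_injP a0)[j jA j_inj].
pose B := A `|` j @` A.
have /choice[u uP] :
    forall k, exists a, (j @` A) k -> A a /\ j a = k.
  move=> k; have [[a Aa <-]|nk] := pselect ((j @` A) k).
    by exists a.
  by exists k => /nk.
have [||r [rA r_inj]] := emb B u.
- by move=> k [|/uP[]].
- move=> k l [Ak|jk]; first by move=> _ /(_ Ak).
  move=> [Al|jl]; first by move=> _ /(_ Al).
  by move=> _ _ kl; have [_ <-] := uP _ jk; have [_ <-] := uP _ jl; rewrite kl.
pose g a b := if pselect (A a /\ A b) then f a b else j (f (r a) (r b)).
have gE a b : A a -> A b -> g a b = f a b.
  by move=> Aa Ab; rewrite /g; case: pselect => // -[].
have gP a b : (A a /\ A b) /\ g a b = f a b \/ g a b = j (f (r a) (r b)).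
  by rewrite /g; case: pselect; [left|right].
have good : infinite_set B /\ pairing_on B g.
  split; first exact: sub_infinite_set (@subsetUl _ _ _) Ainf.
  have frA x y : B x -> B y -> A (f (r x) (r y)).
    by move=> Bx By; apply: fAA; exact: rA.
  split=> [a b Ba Bb|a b c d Ba Bb Bc Bd].
    have [[[Aa Ab] ->]|->] := gP a b; first by left; exact: fAA.
    by right; exists (f (r a) (r b)) => //; exact: frA.
  have [[[Aa Ab] ->]|->] := gP a b; have [[[Ac Ad] ->]|->] := gP c d.
  - exact: finj.
  - by move=> fE; case: (jA _ (frA _ _ Bc Bd)); rewrite -fE; exact: fAA.
  - by move=> fE; case: (jA _ (frA _ _ Ba Bb)); rewrite fE; exact: fAA.
  move=> /(j_inj _ _ (frA _ _ Ba Bb) (frA _ _ Bc Bd)) /finj[]; [exact: rA..|].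
  by move=> /r_inj-> // /r_inj->.
have /pmax/asboolP[BA _] :
    le (exist _ (A, f) (conj Ainf fA)) (exist _ (B, g) good).
  by apply/asboolP; split=> [|a b Aa Ab] /=; [exact: subsetUl|rewrite gE].
by case: (jA _ Aa0); apply: BA; right; exists a0.
Qed.

Lemma card_le_bigcup (K I T : Type) (D : set I) (G : I -> set T) :
  infinite_set [set: K] -> D #<= [set: K] ->
  (forall i, D i -> G i #<= [set: K]) ->
  \bigcup_(i in D) G i #<= [set: K].
Proof.
move=> Kinf DK GK; have [k0 _] := infinite_setN0 Kinf.
have [f [_ f_inj]] := exists_pairing Kinf.
have /(card_le_injP k0)[d _ d_inj] := DK.
have /choice[g g_inj] : forall i, exists g : T -> K,
    D i -> forall x y, G i x -> G i y -> g x = g y -> x = y.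
  move=> i; have [Di|nDi] := pselect (D i); last by exists (fun=> k0).
  by have /(card_le_injP k0)[g _ g_inj] := GK i Di; exists g.
have /choice[h hP] : forall x, exists c, (\bigcup_(i in D) G i) x ->
    exists i, [/\ D i, G i x & c = f (d i) (g i x)].
  move=> x; have [[i Di Gx]|nx] := pselect ((\bigcup_(i in D) G i) x).
    by exists (f (d i) (g i x)) => _; exists i.
  by exists k0 => /nx.
apply/(card_le_injP k0); exists h => // x y /hP[i [Di Gx ->]] /hP[j [Dj Gy ->]].
move=> /f_inj[] // /(d_inj _ _ Di Dj) ij.
by move: Gy; rewrite -ij => Gy /(g_inj _ Di _ _ Gx Gy).
Qed.

Lemma card_le_setU (K T : Type) (A B : set T) : infinite_set [set: K] ->
  A #<= [set: K] -> B #<= [set: K] -> A `|` B #<= [set: K].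
Proof.
move=> Kinf AK BK; rewrite -bigcup2E.
apply: card_le_bigcup => // [|[|[|n]] _ //=].
by have /infiniteP := Kinf.
Qed.

Lemma not_power_card_le (K : Type) (k0 : K) : ~ ([set: set K] #<= [set: K]).
Proof.
move=> /(card_le_injP k0)[f _ f_inj].
pose A := [set k | exists B : set K, f B = k /\ ~ B k].
have nA : ~ A (f A).
  by move=> AfA; have [B [/f_inj BA]] := AfA; rewrite BA.
by apply: (nA); exists A.
Qed.

(** * Successor cardinals *)

Lemma exists_strict_well_order (T : Type) : exists lt : T -> T -> Prop,
  well_founded lt /\ forall x y, [\/ lt x y, x = y | lt y x].
Proof.
elim/Peq: T => T; have [R Rwo] := well_ordering_principle T.
have Rwc : wo_chain R predT by move=> A _; exact: Rwo.
have Rtot x y : R x y \/ R y x by apply/orP; exact: (wo_chainW Rwc).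
have Ranti x y : R x y -> R y x -> x = y.
  by move=> xy yx; apply: (wo_chain_antisymmetric Rwc); rewrite // xy.
have Rmin (A : set T) x : A x -> exists2 z, A z & forall y, A y -> R z y.
  move=> Ax; have [|z [[Az zmin] _]] := Rwo [pred y | `[< A y >]].
    by exists x; apply/asboolP.
  exists z; first exact/asboolP.
  by move=> y Ay; apply: zmin; apply/asboolP.
exists (fun x y => ~ R y x); split=> [x|x y].
  apply: contrapT => nx.
  have [z nz zmin] := Rmin [set x | ~ Acc (fun x y => ~ R y x) x] x nx.
  by apply: nz; split=> y nzy; apply: contrapT => /zmin.
have [xy|nxy] := pselect (R x y); have [yx|nyx] := pselect (R y x).
- by constructor 2; exact: Ranti.
- by constructor 1.
- by constructor 3.
- by have [] := Rtot x y.
Qed.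

(** The order type kappa^+: proper initial segments have size at most kappa, and
    a set of at most kappa elements is strictly bounded.  In a well-order of the
    power set of K take the elements whose initial segment has size at most
    kappa.  They form a set H that does not itself have size at most kappa, as H
    would otherwise contain everything by induction, against Cantor's theorem.
    An unbounded B of size at most kappa would make H the union of B with
    kappa initial segments of size at most kappa. *)
Lemma exists_successor_order (K : Type) : infinite_set [set: K] ->
  exists (T : Type) (lt : T -> T -> Prop), [/\ well_founded lt,
    forall x y, [\/ lt x y, x = y | lt y x],
    forall a, [set b | lt b a] #<= [set: K] &
    forall B : set T, B #<= [set: K] -> exists a, forall b, B b -> lt b a].
Proof.
move=> Kinf; have [lt [ltwf lttot]] := exists_strict_well_order (set K).
pose H := [set a | [set b | lt b a] #<= [set: K]].
have HK : ~ (H #<= [set: K]).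
  move=> HK; have [k0 _] := infinite_setN0 Kinf.
  apply: (not_power_card_le k0).
  suff -> : [set: set K] = H by [].
  apply/seteqP; split=> // a _; elim: (ltwf a) => {}a _ Ha.
  by apply: card_le_trans HK; exact: subset_card_le.
pose T := {a | H a}; pose ltT (x y : T) := lt (sval x) (sval y).
have sval_inj (x y : T) : sval x = sval y -> x = y.
  by case: x y => [x Hx] [y Hy] /= xy; exact: eq_exist.
have cardT (B : set T) : B #<= sval @` B.
  have : sval @` B #= B by apply: inj_card_eq => x y _ _; exact: sval_inj.
  by rewrite card_eq_le => /andP[].
exists T, ltT; split.
- move=> [a Ha]; elim: (ltwf a) Ha => {}a _ IH Ha.
  by split=> -[b Hb] ba; exact: IH.
- move=> x y; have [xy|xy|yx] := lttot (sval x) (sval y).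
  + by constructor 1.
  + by constructor 2; exact: sval_inj.
  + by constructor 3.
- move=> [a Ha]; apply: (card_le_trans (cardT _)).
  apply: (@card_le_trans _ _ _ [set b | lt b a]); last exact: Ha.
  by apply: subset_card_le => _ [[b Hb] ba <-].
move=> B BK; apply: contrapT => nB; apply: HK.
have : H `<=` sval @` B `|` \bigcup_(b in B) [set a | lt a (sval b)].
  move=> a Ha; apply: contrapT => na; apply: nB; exists (exist _ a Ha) => b Bb.
  have [//|ab|ab] := lttot (sval b) a; case: na; first by left; exists b.
  by right; exists b.
move=> /subset_card_le /card_le_trans; apply.
apply: card_le_setU => //; first exact: card_le_trans (card_image_le _ _) BK.
by apply: card_le_bigcup => // -[b Hb] _.
Qed.

(** Recursion in which the value at a depends only on the set of earlier
    values. *)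
Lemma exists_wf_recursion (T Y : Type) (lt : T -> T -> Prop)
  (G : set Y -> Y) : well_founded lt ->
  exists V : T -> Y, forall a, V a = G [set V b | b in [set b | lt b a]].
Proof.
move=> ltwf.
pose step a (f : forall b, lt b a -> Y) :=
  G [set y | exists b (ba : lt b a), f b ba = y].
exists (Fix ltwf (fun=> Y) step) => a; rewrite Fix_eq /step.
  congr G; apply/seteqP; split=> [y [b [ba <-]]|y [b ba <-]].
    by exists b.
  by exists b, ba.
move=> x f g fg; congr G; apply/funext => y.
by apply/propext; split=> -[b [ba <-]]; exists b, ba.
Qed.

(** * Strongly discrete sequences of length kappa^+ *)

Lemma lindelof_countable_cover (X : topologicalType) (A : set X)
    (C : set (set X)) :
  lindelof_space (set_type A) -> C `<=` open -> A `<=` \bigcup_(O in C) O ->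
  exists C', [/\ C' `<=` C, countable C' & A `<=` \bigcup_(O in C') O].
Proof.
move=> Alind Cop AC.
have [||V [VC cV VT]] := Alind [set set_val @^-1` O | O in C].
- by move=> _ [O CO <-]; exists O => //; exact: Cop.
- apply/seteqP; split=> // x _; have [O CO Ox] := AC _ (set_valP x).
  by exists (set_val @^-1` O) => //; exists O.
have /choice[g gP] : forall W : set A, exists O,
    V W -> C O /\ set_val @^-1` O = W.
  move=> W; have [/VC[O CO OW]|nW] := pselect (V W); first by exists O.
  by exists set0.
exists (g @` V); split.
- by move=> _ [W /gP[CO _] <-].
- exact: card_le_trans (card_image_le _ _) cV.
move=> x Ax; have : [set: A] (SigSub (mem_set Ax)) by [].
rewrite -VT => -[W VW Wx]; exists (g W); first by exists W.
by have [_ gW] := gP _ VW; rewrite -{1}gW in Wx.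
Qed.

(** Each point x a has a neighbourhood O a that the later points avoid; removing
    from O a the closure of a set N a that contains the earlier neighbourhoods
    keeps x a and makes the neighbourhoods pairwise disjoint. *)
Lemma strongly_discrete_fresh (X : topologicalType) (T : Type)
    (lt : T -> T -> Prop) (x : T -> X) (O N : T -> set X) (S : set T) :
  (forall a b, [\/ lt a b, a = b | lt b a]) ->
  (forall a, S a -> open (O a) /\ O a (x a)) ->
  (forall a, S a -> ~ closure (N a) (x a)) ->
  (forall a b, S a -> S b -> lt a b -> O a `<=` N b) ->
  strongly_discrete (x @` S).
Proof.
move=> lttot Oop x_far ON.
have /choice[W WP] : forall d, exists W, (x @` S) d ->
    exists a, [/\ S a, x a = d & W = O a `&` ~` closure (N a)].
  move=> d; have [[a Sa xa]|nd] := pselect ((x @` S) d); last by exists set0.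
  by exists (O a `&` ~` closure (N a)) => _; exists a.
exists W; split=> [d /WP[a [Sa <- ->]]|d e].
  have [Oa Oax] := Oop a Sa; split; last by split=> //; exact: x_far.
  by apply: openI => //; exact/closed_openC/closed_closure.
move=> /WP[a [Sa <- ->]] /WP[b [Sb <- ->]] [y [[Oay nay] [Oby nby]]].
have [ab|->//|ba] := lttot a b.
- by case: nby; apply: subset_closure; exact: ON ab _ Oay.
- by case: nay; apply: subset_closure; exact: ON ba _ Oby.
Qed.

Lemma SDL_strictly_quasi_lindelof_at (X : topologicalType) (K : Type) :
  infinite_set [set: K] -> SDL_space X -> (forall x : X, tight_at x K) ->
  strictly_quasi_lindelof_at X K.
Proof.
move=> Kinf sdlX tightX F U I Ui Fcl Uop FU IK UE; apply: contrapT => noV.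
have countK (S : set (set X)) : countable S -> S #<= [set: K].
  by move=> cS; apply: card_le_trans cS _; exact/infiniteP.
(* For a family S of at most kappa open sets, p S consists of a point of F that
   escapes all closures, a member of U around it, and the index of that member.
   Larger families S get the same data without the escape condition. *)
have /choice[p pP] : forall S : set (set X), exists q : X * set X * I,
    [/\ F q.1.1, Ui q.2 q.1.2, q.1.2 q.1.1 & S #<= [set: K] ->
      forall i, ~ closure (\bigcup_(O in S `&` Ui i) O) q.1.1].
  move=> S; apply: contrapT => noq; apply: noV.
  exists (fun i => [set O | [/\ S O, Ui i O & S #<= [set: K]]]); split.
    move=> i; split=> [O []//|].
    have [SK|nSK] := pselect (S #<= [set: K]).
      by apply: card_le_trans SK; apply: subset_card_le => O [].
    have -> : [set O | [/\ S O, Ui i O & S #<= [set: K]]] = set0.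
      by apply/seteqP; split=> // O [].
    exact: card_ge0.
  move=> x Fx; apply: contrapT => nx.
  have [O + Ox] := FU _ Fx; rewrite UE => -[i _ UiO].
  apply: noq; exists (x, O, i); split=> // SK j xj; apply: nx; exists j => //.
  by apply: closureS xj => y [O' [SO' UjO'] O'y]; exists O'.
have /choice[cov covP] : forall D, exists C, [/\ C `<=` U, countable C &
    strongly_discrete D -> D `<=` F -> closure D `<=` \bigcup_(O in C) O].
  move=> D; have [[sD DF]|nD] := pselect (strongly_discrete D /\ D `<=` F).
    have [|C [CU cC DC]] := lindelof_countable_cover (sdlX _ sD) Uop.
      apply: subset_trans FU; rewrite [F](closure_id F).1 //.
      exact: closureS.
    by exists C.
  by exists set0; split=> // sD DF; case: nD.
have covU D : cov D `<=` U by have [] := covP D.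
have covC D : countable (cov D) by have [] := covP D.
have [T [lt [ltwf lttot ltK ltbound]]] := exists_successor_order Kinf.
have [t0 _] := ltbound set0 (card_ge0 _ _).
(* R is the set of the families chosen earlier; the three parts of G R make the
   families increase, record the neighbourhoods of the earlier points, and cover
   the closure of the earlier points of each index. *)
pose G (R : set (set (set X))) : set (set X) :=
  \bigcup_(S in R) S `|` [set (p S).1.2 | S in R] `|`
  \bigcup_i cov [set (p S).1.1 | S in [set S | R S /\ (p S).2 = i]].
have [V VE] := exists_wf_recursion G ltwf.
pose x a := (p (V a)).1.1; pose O a := (p (V a)).1.2; pose ix a := (p (V a)).2.
pose D i (S : set T) := [set x a | a in [set a | S a /\ ix a = i]].
have V_mono a b : lt b a -> V b `<=` V a.
  by move=> ba W VbW; rewrite VE; left; left; exists (V b) => //; exists b.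
have V_O a b : lt b a -> V a (O b).
  by move=> ba; rewrite VE; left; right; exists (V b) => //; exists b.
have V_cov a i : cov (D i [set b | lt b a]) `<=` V a.
  move=> W covW; rewrite VE; right; exists i => //; congr (cov _ _): covW.
  apply/seteqP; split=> [_ [b [ba ib] <-]|_ [_ [[b ba <-] ib] <-]].
    by exists (V b) => //; split=> //; exists b.
  by exists b.
have VU a : V a `<=` U.
  elim: (ltwf a) => {}a _ IH; rewrite VE => W [[[_ [b ba <-]]|]|].
  - exact: IH.
  - move=> [_ [b ba <-] <-]; have [_ + _ _] := pP (V b); rewrite UE.
    by exists (p (V b)).2.
  - by move=> [i _] /covU.
have VK a : V a #<= [set: K].
  elim: (ltwf a) => {}a _ IH; rewrite VE.
  have imK : [set V b | b in [set b | lt b a]] #<= [set: K].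
    exact: card_le_trans (card_image_le _ _) (ltK a).
  apply: card_le_setU => //; first apply: card_le_setU => //.
  - by apply: card_le_bigcup => // _ [b ba <-]; exact: IH.
  - exact: card_le_trans (card_image_le _ _) imK.
  - by apply: card_le_bigcup => // i _; apply: countK; exact: covC.
have Fx a : F (x a) by have [] := pP (V a).
have Ox a : O a (x a) by have [] := pP (V a).
have UiO a : Ui (ix a) (O a) by have [] := pP (V a).
have Oop a : open (O a) by apply: Uop; rewrite UE; exists (ix a).
have x_far a i : ~ closure (\bigcup_(W in V a `&` Ui i) W) (x a).
  by have [_ _ _] := pP (V a); apply; exact: VK.
have D_discrete i S : strongly_discrete (D i S).
  apply: (strongly_discrete_fresh (lt := lt) (O := O)
    (N := fun a => \bigcup_(W in V a `&` Ui i) W)) => // a b [_ ai] _ ab y Oy.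
  by exists (O a) => //; split; [exact: V_O|rewrite -ai].
have DF i S : D i S `<=` F by move=> _ [a _ <-].
(* By tightness and boundedness, every point of the closure of D i already lies
   in the closure of an initial part of D i. *)
have D_closed i : closure (D i setT) `<=` \bigcup_(W in \bigcup_a V a) W.
  move=> y /tightX[B [BD BK By]].
  have /choice[t tP] : forall d, exists a, B d -> ix a = i /\ x a = d.
    move=> d; have [/BD[a [_ ia] xa]|nd] := pselect (B d); first by exists a.
    by exists t0 => /nd.
  have [a aB] := ltbound (t @` B) (card_le_trans (card_image_le _ _) BK).
  have /closureS/(_ _ By) : B `<=` D i [set b | lt b a].
    move=> d Bd; have [id xd] := tP _ Bd; exists (t d) => //; split=> //.
    by apply: aB; exists d.
  have [_ _ +] := covP (D i [set b | lt b a]).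
  move=> /(_ (D_discrete _ _) (DF _ _)) /[apply] -[W /V_cov VW Wy].
  by exists W => //; exists a.
have /choice[b bP] : forall i, exists b,
    closure (D i setT) `<=` \bigcup_(W in V b) W.
  move=> i; have [|C [CV cC DC]] :=
    lindelof_countable_cover (sdlX _ (D_discrete i setT)) _ (D_closed i).
    by move=> W [a _ /VU/Uop].
  have /choice[t tP] : forall W, exists a, C W -> V a W.
    move=> W; have [/CV[a _ VW]|nW] := pselect (C W); first by exists a.
    by exists t0 => /nW.
  have tCK := card_le_trans (card_image_le t C) (countK _ cC).
  have [b bC] := ltbound _ tCK.
  exists b => y /DC[W CW Wy]; exists W => //; apply: (V_mono _ (t W)).
    by apply: bC; exists W.
  exact: tP.
(* The stage a lies beyond all the b i, yet x a is covered at stage b (ix a). *)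
have [a ab] := ltbound (range b) (card_le_trans (card_image_le _ _) IK).
have [W VW Wx] : (\bigcup_(W in V (b (ix a))) W) (x a).
  by apply: bP; apply: subset_closure; exists a.
have /V_mono/(_ _ VW) VaW : lt (b (ix a)) a by apply: ab; exists (ix a).
have := VU _ _ VaW; rewrite UE => -[i _ UiW].
by apply: (x_far a i); apply: subset_closure; exists W.
Qed.

Lemma card_sqL_le (X : topologicalType) : SDL_space X ->
  [set: sqL X] #<= [set: tightness X].
Proof.
move=> sdlX; have [tinf tX _] := tightnessP X.
have [_ _] := sqLP X; apply=> //.
apply: SDL_strictly_quasi_lindelof_at => // x A.
have [_ tx _] := tightness_atP x; move=> /tx[B [BA BK Bx]].
exists B; split=> //.
exact: card_le_trans (tX x).
Qed.

Theorem corollary3p2 :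
  (forall X : topologicalType, SDL_space X ->
    [set: sqL X] #<= [set: tightness X]) /\
  (forall X : topologicalType, SDL_space X -> countably_tight X ->
    strictly_quasi_lindelof X).
Proof.
split=> [|X sdlX tX]; first exact: card_sqL_le.
have [sinf _ _] := sqLP X.
rewrite /strictly_quasi_lindelof card_eq_le; apply/andP; split.
  by rewrite -(card_le_eqr tX); exact: card_sqL_le.
exact/infiniteP.
Qed.
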